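(* The edge Folkman number $F_e(3,5;13)$ satisfies $F_e(3,5;13)\leq 21$. Here $F_e(3,5;13)$ is the minimum of $|V(G)|$ over all finite simple graphs $G$ such that $G$ contains no 13-clique and $G\stackrel{e}{\to}(3,5)$, i.e. in every 2-coloring of $E(G)$ there is either a 3-clique of $G$ all of whose edges have the first color or a 5-clique of $G$ all of whose edges have the second color.
   Context: All graphs are finite, undirected, without loops or multiple edges. A $p$-clique of a graph $G$ is a set of $p$ pairwise adjacent vertices, and $cl(G)$ denotes the largest $p$ such that $G$ contains a $p$-clique. The symbol $G\stackrel{e}{\to}(a_1,\ldots,a_r)$ means that in every $r$-coloring of $E(G)$ there is, for some $i\in\{1,\ldots,r\}$, an $a_i$-clique all of whose edges have color $i$. The edge Folkman numbers are defined by $F_e(a_1,\ldots,a_r;q)=\min\{|V(G)|: G\stackrel{e}{\to}(a_1,\ldots,a_r)\text{ and } cl(G)<q\}$. *)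

(* Defs.v *)
From mathcomp Require Import all_boot.

Set Implicit Arguments.
Unset Strict Implicit.
Unset Printing Implicit Defensive.

Record sgraph := SGraph {
  vertex :> finType;
  adj : rel vertex;
  adj_sym : symmetric adj;
  adj_irr : irreflexive adj
}.

Definition edges (G : sgraph) : {set {set G}} :=
  [set e | [exists x, exists y, adj x y && (e == [set x; y])]].

Definition edge (G : sgraph) := {e : {set G} | e \in edges G}.

Definition clique (G : sgraph) (K : {set G}) : bool :=
  [forall x in K, forall y in K, (x != y) ==> adj x y].

Definition pclique (G : sgraph) (p : nat) (K : {set G}) : bool :=
  clique K && (#|K| == p).

Definition cl (G : sgraph) : nat := \max_(K : {set G} | clique K) #|K|.

(* The edges of a clique K are the edges of G included in K. *)
Definition monochromatic (G : sgraph) (r : nat) (c : edge G -> 'I_r)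
    (i : 'I_r) (K : {set G}) : Prop :=
  forall e : edge G, val e \subset K -> c e = i.

(* G -e-> (a_1, ..., a_r), with colors numbered from 0 *)
Definition edge_arrows (G : sgraph) (r : nat) (a : r.-tuple nat) : Prop :=
  forall c : edge G -> 'I_r,
    exists (i : 'I_r) (K : {set G}),
      pclique (tnth a i) K /\ monochromatic c i K.

(* F_e(a_1, ..., a_r; q) = m.  This is a predicate on m, rather than a function
   with a default value, because the set of orders can be empty; it holds of no
   m in that case, and of exactly one m otherwise. *)
Definition edge_Folkman_number (r : nat) (a : r.-tuple nat) (q m : nat) :
    Prop :=
  (exists G : sgraph, [/\ #|G| = m, edge_arrows G a & cl G < q]) /\
  (forall G : sgraph, edge_arrows G a -> cl G < q -> m <= #|G|).

(* Main.v *)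
Require Import Defs.
From mathcomp Require Import all_boot zify.
From Stdlib Require Import Classical.

(** The graph is the join [KQ] of K_8 and Q, where Q is the complement of the
    13-vertex Ramsey graph for R(3,5): independent sets of Q have at most 2
    vertices, cliques at most 4 (so cl(KQ) = 12), and whenever the vertices of
    Q are split in two, the first part contains a triangle or the second one a
    4-clique. Suppose an edge coloring has no red triangle and no blue
    5-clique. For a vertex v of K_8 let r be its red degree in K_8, A its red
    neighborhood in Q and B the rest of Q. The red neighborhood of v contains
    no 5-clique, and the blue one no 9-clique since R(3,4) = 9; hence
    r + cl(A) <= 4 and 7 - r + cl(B) <= 8. The splitting property of Q excludes
    r = 1 and r = 2, so either r >= 3 and |A| <= 2, or r = 0 and |B| <= 2.
    The second case is impossible: K_8 is not entirely blue, so some u of K_8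
    has at most 2 red neighbors in Q; then A contains 9 blue neighbors of u,
    hence a 4-clique of Q, which is blue and extends by u. So every vertex of
    K_8 has at most 2 red neighbors in Q. As R(3,3) = 6, K_8 contains a blue
    triangle; its at least 7 common blue neighbors in Q contain a triangle
    of Q, which is either red or has a blue edge completing a blue 5-clique. *)

Set Implicit Arguments.
Unset Strict Implicit.
Unset Printing Implicit Defensive.

(** * Homogeneous sets and the handshake lemma *)

Lemma ex_subset_card (T : finType) (A : {set T}) n :
  n <= #|A| -> exists2 B : {set T}, B \subset A & #|B| = n.
Proof.
move=> le_n; exists [set x in take n (enum A)].
  by apply/subsetP=> x; rewrite inE => /mem_take; rewrite mem_enum.
rewrite cardsE (card_uniqP _) ?take_uniq ?enum_uniq //.
by rewrite size_takel // -cardE.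
Qed.

Definition homog (T : finType) (r : rel T) (K : {set T}) : bool :=
  [forall x in K, forall y in K, (x != y) ==> r x y].

Definition has_homog (T : finType) (r : rel T) k (S : {set T}) : bool :=
  [exists K : {set T}, [&& K \subset S, #|K| == k & homog r K]].

Section Homogeneous.
Variable T : finType.
Implicit Types (r : rel T) (K S A B : {set T}).

Lemma homogP r K :
  reflect {in K &, forall x y, x != y -> r x y} (homog r K).
Proof.
apply: (iffP idP) => [hK x y xK yK | hK].
  by move/forall_inP/(_ x xK)/forall_inP/(_ y yK)/implyP: hK.
apply/forall_inP => x xK; apply/forall_inP => y yK; apply/implyP; exact: hK.
Qed.

Lemma has_homogP r k S :
  reflect (exists K, [/\ K \subset S, #|K| = k & homog r K])
          (has_homog r k S).
Proof.
apply: (iffP existsP) => -[K].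
  by case/and3P=> ? /eqP ? ?; exists K.
by case=> ? ? ?; exists K; apply/and3P; split=> //; apply/eqP.
Qed.

Lemma homogS r A B : A \subset B -> homog r B -> homog r A.
Proof.
move=> /subsetP sAB /homogP hB; apply/homogP => x y xA yA.
by apply: hB; apply: sAB.
Qed.

Lemma homog_sub r1 r2 K : {in K &, subrel r1 r2} -> homog r1 K -> homog r2 K.
Proof.
move=> sub12 /homogP h1; apply/homogP => x y xK yK xy.
by apply: sub12 => //; apply: h1.
Qed.

Lemma homogI r1 r2 K :
  homog r1 K -> homog r2 K -> homog (fun x y => r1 x y && r2 x y) K.
Proof.
move=> /homogP h1 /homogP h2; apply/homogP => x y xK yK xy.
by rewrite h1 ?h2.
Qed.

Lemma homogU r A B : symmetric r -> homog r A -> homog r B ->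
  {in A & B, forall x y, r x y} -> homog r (A :|: B).
Proof.
move=> rC /homogP hA /homogP hB hAB; apply/homogP => x y.
case/setUP=> [xA|xB] /setUP[yA|yB] xy.
- exact: hA.
- exact: hAB.
- by rewrite rC hAB.
- exact: hB.
Qed.

Lemma homog1 r x : homog r [set x].
Proof. by apply/homogP => y z /set1P-> /set1P->; rewrite eqxx. Qed.

Lemma homog_has r k K : homog r K -> k <= #|K| -> has_homog r k K.
Proof.
move=> hK /ex_subset_card[L sLK cL]; apply/has_homogP; exists L; split=> //.
exact: homogS hK.
Qed.

Lemma has_homogS r k A B : A \subset B -> has_homog r k A -> has_homog r k B.
Proof.
move=> sAB /has_homogP[K [sKA cK hK]]; apply/has_homogP; exists K; split=> //.
exact: subset_trans sAB.
Qed.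

Lemma has_homog_setU1 r k S x : symmetric r -> x \in S ->
  has_homog r k [set y in S :\ x | r x y] -> has_homog r k.+1 S.
Proof.
move=> rC xS /has_homogP[K [/subsetP sK cK hK]].
apply/has_homogP; exists (x |: K); split.
- by rewrite subUset sub1set xS; apply/subsetP => y /sK; rewrite !inE -andbA => /and3P[].
- have xK : x \notin K by apply/negP => /sK; rewrite !inE eqxx.
  by rewrite cardsU1 xK cK.
- apply: homogU => //; first exact: homog1.
  by move=> y z /set1P-> /sK; rewrite inE => /andP[].
Qed.

(** Induction deleting a vertex [x]: each edge at [x] counts once at [x] and once at its other end,
    so the sum drops by an even number. *)
Lemma sum_degree_even r S : symmetric r -> irreflexive r ->
  ~~ odd (\sum_(x in S) #|[set y in S | r x y]|).
Proof.
move=> rC rI; move: {2}#|S| (erefl #|S|) => n.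
elim: n S => [S /cards0_eq-> | n IHn S cS]; first by rewrite big_set0.
have /card_gt0P[x xS] : 0 < #|S| by rewrite cS.
rewrite -(setD1K xS); set S' := S :\ x.
have xS' : x \notin S' by rewrite setD11.
have {IHn} IH : ~~ odd (\sum_(y in S') #|[set z in S' | r y z]|).
  by apply: IHn; rewrite (cardsD1 x) xS in cS; case: cS.
have deg y : #|[set z in x |: S' | r y z]| = r y x + #|[set z in S' | r y z]|.
  have [ryx|ryx] := boolP (r y x); last first.
    apply: eq_card => z; rewrite [LHS]inE [RHS]inE in_setU1.
    by case: eqP => //= ->; rewrite (negPf ryx) andbF.
  transitivity #|x |: [set z in S' | r y z]|; last first.
    by rewrite cardsU1 inE (negPf xS').
  apply: eq_card => z; rewrite in_setU1 !inE andb_orl.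
  by case: eqP => // ->; rewrite ryx.
rewrite big_setU1 //= deg rI (eq_bigr _ (fun y _ => deg y)) big_split /= addnA.
have -> : #|[set z in S' | r x z]| = \sum_(y in S') r y x.
  rewrite -sum1_card big_mkcond [RHS]big_mkcond; apply: eq_bigr => y _.
  by rewrite inE rC; case: (y \in S'); case: (r y x).
by rewrite oddD (negPf IH) addbF addnn odd_double.
Qed.

End Homogeneous.

(** * Upper bounds for small Ramsey numbers *)

(** This is R(a,b) <= n, stated for subsets [S] so that it applies directly inside neighborhoods. *)
Definition ramsey a b n := forall (T : finType) (r : rel T), symmetric r ->
  forall S : {set T}, n <= #|S| ->
  has_homog r a S || has_homog (fun x y => ~~ r x y) b S.

Lemma ramseyC a b n : ramsey a b n -> ramsey b a n.
Proof.
move=> R T r rC S leS; rewrite orbC.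
have nrC : symmetric (fun x y => ~~ r x y) by move=> x y; rewrite rC.
case/orP: (R T _ nrC S leS) => [-> //|/has_homogP[K [sK cK hK]]].
apply/orP; right; apply/has_homogP; exists K; split=> //.
by apply: homog_sub hK => x y _ _ /=; rewrite negbK.
Qed.

Lemma ramsey2n n : ramsey 2 n n.
Proof.
move=> T r rC S leS; have [//|no2] := boolP (has_homog r 2 S).
have [L sLS cL] := ex_subset_card leS.
apply: (@has_homogS _ _ _ L) => //; apply: homog_has; last by rewrite cL.
apply/homogP => x y xL yL xy; apply: contra no2 => rxy.
apply/has_homogP; exists [set x; y]; split; last 1 first.
- by apply: homogU => //; try exact: homog1; move=> z t /set1P-> /set1P->.
- by rewrite subUset !sub1set !(subsetP sLS).
- by rewrite cards2 xy.
Qed.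

(** A smaller homogeneous set found among the neighbors, or the non-neighbors, of [x] grows by [x].
    Both recursions below rest on this step. *)
Lemma ramsey_vertex a b n m (T : finType) (r : rel T) (S : {set T}) x :
  ramsey a b.+1 n -> ramsey a.+1 b m -> symmetric r -> x \in S ->
  (n <= #|[set y in S :\ x | r x y]|) ||
    (m <= #|[set y in S :\ x | ~~ r x y]|) ->
  has_homog r a.+1 S || has_homog (fun x y => ~~ r x y) b.+1 S.
Proof.
move=> Rn Rm rC xS; have sN p : [set y in S :\ x | p y] \subset S.
  by apply/subsetP => y; rewrite !inE -andbA => /and3P[].
have nrC : symmetric (fun x y => ~~ r x y) by move=> y z; rewrite rC.
case/orP=> [/(Rn T r rC)|/(Rm T r rC)] /orP[] hK.
- by rewrite (has_homog_setU1 _ _ hK).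
- by rewrite (has_homogS _ hK) ?orbT.
- by rewrite (has_homogS _ hK).
- by rewrite (has_homog_setU1 nrC xS hK) orbT.
Qed.

Lemma card_degree (T : finType) (r : rel T) (S : {set T}) x : x \in S ->
  #|S| = (#|[set y in S :\ x | r x y]| + #|[set y in S :\ x | ~~ r x y]|).+1.
Proof.
move=> xS; rewrite (cardsD1 x) xS add1n; congr _.+1.
rewrite -(cardsID [set y | r x y]); congr (_ + _).
  by apply: eq_card => y; rewrite !inE.
by apply: eq_card => y; rewrite !inE andbC.
Qed.

(** Erdős-Szekeres recursion: with fewer than [n] neighbors and fewer than [m] non-neighbors of [x],
    [S] would have fewer than [n + m] vertices. *)
Lemma ramseyS a b n m : ramsey a b.+1 n -> ramsey a.+1 b m -> 0 < n + m ->
  ramsey a.+1 b.+1 (n + m).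
Proof.
move=> Rn Rm nm_gt0 T r rC S leS.
have /card_gt0P[x xS] : 0 < #|S| by apply: leq_trans leS.
by apply: (ramsey_vertex Rn Rm rC xS); move: leS; rewrite (card_degree r xS); lia.
Qed.

Lemma ramseyS_even a b n m : ramsey a b.+1 n -> ramsey a.+1 b m ->
  0 < n -> 0 < m -> ~~ odd n -> ~~ odd m -> ramsey a.+1 b.+1 (n + m).-1.
Proof.
move=> Rn Rm n_gt0 m_gt0 en em T r rC S /ex_subset_card[L sLS cL].
suff: has_homog r a.+1 L || has_homog (fun x y => ~~ r x y) b.+1 L.
  by case/orP=> /(has_homogS sLS) ->; rewrite ?orbT.
(* The handshake lemma asks for an irreflexive relation, while [r] may hold on the diagonal. *)
pose r' x y := (x != y) && r x y.
have [/existsP[x /andP[xL]]|/existsPn degL] := boolP [exists x, (x \in L) &&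
    ((n <= #|[set y in L :\ x | r x y]|)
      || (m <= #|[set y in L :\ x | ~~ r x y]|))].
  exact: ramsey_vertex.
(* Otherwise r is (n - 1)-regular on the n + m - 1 vertices of L, and both
   numbers are odd. *)
have /negP[] : ~~ odd (\sum_(x in L) #|[set y in L | r' x y]|).
  by apply: sum_degree_even => [x y|x]; rewrite /r' ?eqxx // eq_sym rC.
rewrite (eq_bigr (fun=> n.-1)) ?sum_nat_const ?cL; first by rewrite oddM; lia.
move=> x xL; move: (degL x) (card_degree r xL).
rewrite xL /= negb_or cL.
have -> : [set y in L | r' x y] = [set y in L :\ x | r x y].
  by apply/setP => y; rewrite !inE /r' eq_sym; case: eqP => //=; rewrite andbF.
by lia.
Qed.

Lemma ramsey33 : ramsey 3 3 6.
Proof. exact: ramseyS (@ramsey2n 3) (ramseyC (@ramsey2n 3)) _. Qed.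

(** 9 = 4 + 6 - 1, the parity gain being available because 4 and 6 are even. *)
Lemma ramsey34 : ramsey 3 4 9.
Proof. exact: ramseyS_even (@ramsey2n 4) ramsey33 _ _ _ _. Qed.

(** * Red-blue colorings of the join of K_8 and Q *)

Section Join.

Variables (V : finType) (e red : rel V) (S Q : {set V}).
Let blue x y := e x y && ~~ red x y.

Implicit Types A K X : {set V}.

Hypotheses (eC : symmetric e) (eI : irreflexive e).
Hypotheses (redC : symmetric red) (red_e : subrel red e).
Hypotheses (S_clique : homog e S) (cardS : #|S| = 8) (cardQ : #|Q| = 13).
Hypothesis SQ_join : {in S & Q, forall x y, e x y}.
Hypothesis Q_indep : ~~ has_homog (fun x y => ~~ e x y) 3 Q.
Hypothesis Q_split : forall X : {set V}, X \subset Q ->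
  has_homog e 3 X || has_homog e 4 (Q :\: X).

Hypothesis no_red3 : ~~ has_homog red 3 setT.
Hypothesis no_blue5 : ~~ has_homog blue 5 setT.

Let blueC : symmetric blue.
Proof. by move=> x y; rewrite /blue eC redC. Qed.

Let blue_small K : homog blue K -> #|K| <= 4.
Proof.
move=> hK; rewrite leqNgt; apply: contra no_blue5 => cK.
exact: has_homogS (subsetT K) (homog_has hK cK).
Qed.

Let redI x : red x x = false.
Proof. by apply/negP => /red_e; rewrite eI. Qed.

Let no_triangle x y z : red x y -> red x z -> red y z = false.
Proof.
move=> rxy rxz; apply/negP => ryz; case/negP: no_red3.
apply/has_homogP; exists (x |: (y |: [set z])); split; rewrite ?subsetT //.
  rewrite !cardsU1 cards1 !inE negb_or.
  by do !(case: eqP => [eq|_] /=; first by rewrite ?eq ?redI in rxy rxz ryz).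
apply: homogU => //; first exact: homog1.
  apply: homogU => //; try exact: homog1.
  by move=> _ _ /set1P-> /set1P->.
by move=> _ t /set1P-> /set2P[]->.
Qed.

(** A red edge inside [K] would close a red triangle with [v], so [K] is a blue clique. *)
Let red_clique_small v K : homog e K -> {in K, forall x, red v x} -> #|K| <= 4.
Proof.
move=> /homogP hK rK; apply: blue_small; apply/homogP => x y xK yK xy.
by rewrite /blue hK // (no_triangle (rK x xK) (rK y yK)).
Qed.

Let has_blue K k : homog e K -> has_homog (fun x y => ~~ red x y) k K ->
  exists L : {set V}, [/\ L \subset K, #|L| = k & homog blue L].
Proof.
move=> hK /has_homogP[L [sLK cL hL]]; exists L; split=> //.
by apply: homogI => //; apply: homogS hK.
Qed.

Let no_red3_in K : has_homog red 3 K = false.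
Proof. by apply: contraNF no_red3; apply: has_homogS (subsetT K). Qed.

(** Among nine vertices, R(3,4) <= 9 gives a blue 4-clique, which [v] extends to a blue 5-clique. *)
Let blue_clique_small v K : homog e K -> {in K, forall x, blue v x} -> #|K| <= 8.
Proof.
move=> hK bK; rewrite leqNgt; apply/negP => /(ramsey34 redC); rewrite no_red3_in /=.
case/(has_blue hK) => L [/subsetP sLK cL hL].
have vL : v \notin L by apply/negP => /sLK/bK; rewrite /blue eI.
have: homog blue (v |: L).
  by apply: homogU => //; [apply: homog1 | move=> _ y /set1P-> /sLK/bK].
by move/blue_small; rewrite cardsU1 vL cL.
Qed.

Let SQ_disjoint x : x \in S -> x \in Q -> False.
Proof. by move=> xS /(SQ_join xS); rewrite eI. Qed.

Let e_clique_union A K : A \subset S -> K \subset Q -> homog e K ->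
  homog e (A :|: K) /\ #|A :|: K| = #|A| + #|K|.
Proof.
move=> /subsetP sAS /subsetP sKQ hK; split.
  apply: homogU => //; first by apply: homogS S_clique; apply/subsetP.
  by move=> x y /sAS xS /sKQ; apply: SQ_join.
rewrite cardsU (_ : A :&: K = set0) ?cards0 ?subn0 //.
by apply/setP => x; rewrite !inE; apply/negP => /andP[/sAS ? /sKQ]; apply: SQ_disjoint.
Qed.

Let redS v := [set x in S | red v x].
Let redQ v := [set y in Q | red v y].

Let card_red_clique v K : K \subset redQ v -> homog e K -> #|redS v| + #|K| <= 4.
Proof.
move=> /subsetP sK hK.
have [||h <-] := e_clique_union (A := redS v) (K := K) _ _ hK.
- by apply/subsetP => x; rewrite inE => /andP[].
- by apply/subsetP => x /sK; rewrite inE => /andP[].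
apply: (red_clique_small (v := v)) h _ => x.
by case/setUP => [|/sK]; rewrite inE => /andP[].
Qed.

(** If r is the size of [redS v], then [v] has 7 - r blue neighbors in K_8. Together with [K] they
    form a clique of blue neighbors, so 7 - r + |K| <= 8. *)
Let card_blue_clique v K : v \in S -> K \subset Q :\: redQ v -> homog e K ->
  #|K| <= #|redS v|.+1.
Proof.
move=> vS /subsetP sK hK; pose B := (S :\ v) :\: redS v.
have sKQ : K \subset Q by apply/subsetP => x /sK; rewrite inE => /andP[].
have sBS : B \subset S by apply/subsetP => x; rewrite !inE => /and3P[].
have [h cBK] := e_clique_union sBS sKQ hK.
have cB : #|B| + #|redS v| = 7.
  have := cardsID (redS v) (S :\ v).
  rewrite (setIidPr _); last first.
    by apply/subsetP => x; rewrite !inE => /andP[-> rx]; case: eqP rx => // ->; rewrite redI.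
  by have := cardsD1 v S; rewrite vS cardS /B; lia.
have : #|B :|: K| <= 8.
  apply: (blue_clique_small (v := v)) h _ => x; rewrite /blue.
  case/setUP => [|/sK]; rewrite !inE.
    case/and3P=> nr xv xS; rewrite xS /= in nr; rewrite nr andbT.
    by move/homogP: S_clique; apply=> //; rewrite eq_sym.
  by case/andP=> nr xQ; rewrite xQ /= in nr; rewrite nr SQ_join.
by rewrite cBK; lia.
Qed.

Let e_ramsey k n X : ramsey k 3 n -> X \subset Q -> n <= #|X| -> has_homog e k X.
Proof.
move=> R sXQ /(R _ _ eC)/orP[//|h3].
by case/negP: Q_indep; apply: has_homogS h3.
Qed.

Let redS_redQ v : v \in S ->
  #|redQ v| <= 2 \/ redS v = set0 /\ #|Q :\: redQ v| <= 2.
Proof.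
move=> vS; have sAQ : redQ v \subset Q by apply/subsetP => x; rewrite inE => /andP[].
have A_clique k : has_homog e k (redQ v) -> #|redS v| + k <= 4.
  by case/has_homogP=> K [sK <- hK]; apply: card_red_clique.
have B_clique k : has_homog e k (Q :\: redQ v) -> k <= #|redS v|.+1.
  by case/has_homogP=> K [sK <- hK]; apply: card_blue_clique hK.
(* Splitting Q into A = [redQ v] and its complement B gives r <= 1 or r >= 3; exchanging the roles
   of A and B gives r >= 2 or r = 0. *)
have r03 : #|redS v| = 0 \/ 3 <= #|redS v|.
  case/orP: (Q_split sAQ) => [/A_clique|/B_clique]; last by lia.
  case/orP: (Q_split (subsetDl Q (redQ v))) => [/B_clique|]; first by lia.
  by rewrite setDDr setDv set0U (setIidPr sAQ) => /A_clique; lia.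
have [|A_gt2] := leqP #|redQ v| 2; [by left | right].
(* Three vertices of Q are never independent, so they span an edge. In A this gives r + 2 <= 4, and
   in B it would give 2 <= r + 1. *)
have := A_clique _ (e_ramsey (@ramsey2n 3) sAQ A_gt2) => ?.
have r0 : #|redS v| = 0 by lia.
split; first exact: cards0_eq.
rewrite leqNgt; apply/negP => /(e_ramsey (@ramsey2n 3) (subsetDl _ _))/B_clique.
by rewrite r0.
Qed.

Let exists_redS : exists2 u, u \in S & redS u != set0.
Proof.
apply/exists_inP; apply: contraT; rewrite negb_exists_in => /forall_inP none.
suff /blue_small : homog blue S by rewrite cardS.
apply/homogP => x y xS yS xy; rewrite /blue (homogP _ _ S_clique) //=.
by apply/negP => rxy; have := none x xS; rewrite negbK => /eqP/setP/(_ y); rewrite !inE yS rxy.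
Qed.

Let redQ_small v : v \in S -> #|redQ v| <= 2.
Proof.
move=> vS; case: (redS_redQ vS) => // -[_ Bv].
have [u uS ru] := exists_redS.
have Au : #|redQ u| <= 2 by case: (redS_redQ uS) => // -[ru0]; rewrite ru0 eqxx in ru.
have sXQ : redQ v :\: redQ u \subset Q by apply/subsetP => x; rewrite !inE => /and3P[].
have sAQ : redQ v \subset Q by apply/subsetP => x; rewrite inE => /andP[].
(* 9 = 13 - 2 - 2, just enough for R(4,3) to yield a 4-clique of Q. *)
have cX : 9 <= #|redQ v :\: redQ u|.
  have := cardsID (redQ u) (redQ v); have := cardsID (redQ v) Q.
  rewrite cardQ (setIidPr sAQ); have := subset_leq_card (subsetIr (redQ v) (redQ u)).
  by lia.
case/has_homogP: (e_ramsey (ramseyC ramsey34) sXQ cX) => K [/subsetP sK cK hK].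
have bK : homog blue K.
  move/homogP: hK => hK; apply/homogP => x y xK yK xy; rewrite /blue hK //.
  move: (sK x xK) (sK y yK); rewrite !inE => /and3P[_ _ vx] /and3P[_ _ vy].
  by rewrite (no_triangle vx vy).
have uK : u \notin K by apply/negP => /sK/(subsetP sXQ); apply: SQ_disjoint.
have : homog blue (u |: K).
  apply: homogU => //; first exact: homog1.
  move=> _ y /set1P-> /sK; rewrite !inE => /and3P[nr yQ _].
  by rewrite yQ /= in nr; rewrite /blue nr SQ_join.
by move/blue_small; rewrite cardsU1 uK cK.
Qed.

Lemma join_no_coloring : False.
Proof.
have /(ramsey33 redC) : 6 <= #|S| by rewrite cardS.
rewrite no_red3_in /= => /(has_blue S_clique)[K [sKS cK bK]].
pose X := Q :\: \bigcup_(v in K) redQ v.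
(* The three vertices of [K] exclude at most 3 * 2 of the 13 vertices of Q. *)
have cX : 6 <= #|X|.
  have cU : #|\bigcup_(v in K) redQ v| <= 6.
    have <- : \sum_(v in K) 2 = 6 by rewrite sum_nat_const cK.
    apply: (big_ind2 (fun A n => #|A| <= n)) => [|A m B n Am Bn|v vK].
    - by rewrite cards0.
    - by apply: leq_trans (leq_card_setU A B) (leq_add Am Bn).
    - by apply: redQ_small; apply: (subsetP sKS).
  have := subset_leq_card (subsetIr Q (\bigcup_(v in K) redQ v)).
  by have := cardsID (\bigcup_(v in K) redQ v) Q; rewrite cardQ /X; lia.
have [L [/subsetP sL cL hL]] := has_homogP _ _ _ (e_ramsey ramsey33 (subsetDl _ _) cX).
have KL v y : v \in K -> y \in L -> blue v y.
  move=> vK /sL; rewrite !inE => /andP[nU yQ].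
  rewrite /blue SQ_join ?(subsetP sKS) //=; apply: contra nU => rvy.
  by apply/bigcupP; exists v => //; rewrite inE yQ.
have rL : homog red L.
  apply/homogP => x y xL yL xy; apply: contraT => nr.
  have bxy : homog blue [set x; y].
    apply: homogU => //; try exact: homog1.
    by move=> _ _ /set1P-> /set1P->; rewrite /blue nr (homogP _ _ hL).
  have : homog blue (K :|: [set x; y]).
    by apply: homogU => // v z vK /set2P[]->; apply: KL.
  move/blue_small; rewrite cardsU cK cards2 xy (_ : _ :&: _ = set0) ?cards0 //.
  (* A common vertex would be a blue neighbor of itself. *)
  apply/setP => z; rewrite !inE; apply/negP => /andP[zK zxy].
  suff /(KL _ _ zK) : z \in L by rewrite /blue eI.
  by case/orP: zxy => /eqP->.
have := homog_has rL (leqnn _); rewrite cL.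
by rewrite no_red3_in.
Qed.

End Join.

(** * Verified exhaustive search for cliques *)

Section CliqueSearch.

Variables (T : eqType) (r : rel T).
Implicit Types (s t X Y : seq T) (p q : pred T).

(** The filtered list is not a subterm of [s], so the outer recursion is on [k]; the inner one runs
    through the candidates for the first vertex. *)
Fixpoint has_clique k s : bool :=
  if k is k'.+1 then
    (fix aux s := if s is x :: s' then
       has_clique k' [seq y <- s' | r x y] || aux s' else false) s
  else true.

Lemma has_cliqueP k s :
  reflect (exists t, [/\ subseq t s, pairwise r t & size t = k])
          (has_clique k s).
Proof.
elim: k s => [|k IHk] s.
  by apply: ReflectT; exists [::]; split; rewrite ?sub0seq.
elim: s => [|x s IHs].
  by apply: ReflectF => -[t [/eqP-> _]].
apply: (iffP orP) => [[/IHk[t []]|/IHs[t [st rt ct]]]|[t []]].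
- rewrite subseq_filter => /andP[xt st] rt ct; exists (x :: t).
  by split; rewrite /= ?eqxx ?xt ?ct.
- by exists t; split=> //; apply: subseq_trans st (subseq_cons s x).
case: t => // y t /= + + [ct].
case: (y =P x) => [->|_] st /andP[yt rt].
  by left; apply/IHk; exists t; rewrite subseq_filter yt st.
by right; apply/IHs; exists (y :: t); rewrite /= yt rt ct.
Qed.

(** [X] and [Y] hold the vertices placed so far. A branch stops once either contains its clique,
    which prunes the tree of all bipartitions. *)
Fixpoint clique_split k l s X Y : bool :=
  [|| has_clique k X, has_clique l Y |
    if s is x :: s' then
      clique_split k l s' (x :: X) Y && clique_split k l s' X (x :: Y)
    else false].

(** The proof follows the branch that sends each vertex to a side whose predicate it satisfies, so
    one computation serves all [p] and [q] covering [s]. *)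
Lemma clique_splitP k l s X Y p q :
  clique_split k l s X Y -> all p X -> all q Y -> all (predU p q) s ->
  (exists t, [/\ all p t, pairwise r t & size t = k]) \/
  (exists t, [/\ all q t, pairwise r t & size t = l]).
Proof.
have found m Z (o : pred T) : has_clique m Z -> all o Z ->
    exists t, [/\ all o t, pairwise r t & size t = m].
  move=> /has_cliqueP[t [/mem_subseq st rt ct]] /allP oZ; exists t; split=> //.
  by apply/allP => x /st/oZ.
elim: s X Y => [|x s IHs] X Y /=.
  by case/or3P=> // h pX qY _; [left | right]; apply: found h _.
case/or3P=> [h|h|/andP[hX hY]] pX qY; try by [left; apply: found h _|right; apply: found h _].
case/andP=> /orP[px|qx] ps; [apply: IHs hX _ _ ps | apply: IHs hY _ _ ps] => //=.
  by rewrite px.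
by rewrite [q x]qx.
Qed.

End CliqueSearch.

(** * Transfer between lists and sets *)

Lemma has_homog_seq (T : finType) (r : rel T) k (t : seq T) (S : {set T}) :
  symmetric r -> irreflexive r -> pairwise r t -> size t = k ->
  {subset t <= S} -> has_homog r k S.
Proof.
move=> rC rI rt <- sub; apply/has_homogP; exists [set x in t]; split.
- by apply/subsetP => x; rewrite inE => /sub.
- by rewrite cardsE; apply/card_uniqP; apply: pairwise_uniq rt.
elim: t rt {sub} => [_|x t IHt /= /andP[/allP xt /IHt ht]].
  by apply/homogP => x; rewrite inE.
rewrite set_cons; apply: homogU => //; first exact: homog1.
by move=> _ y /set1P->; rewrite inE => /xt.
Qed.

Lemma homog_has_clique n (r : rel nat) (K : {set 'I_n}) :
  homog (fun i j => r (val i) (val j)) K -> has_clique r #|K| (iota 0 n).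
Proof.
move=> /homogP hK; apply/has_cliqueP; exists (map val (enum K)); split.
- by rewrite -val_enum_ord map_subseq // enumT /enum_mem filter_subseq.
- rewrite pairwise_map; have := enum_uniq K; rewrite uniq_pairwise.
  by apply: (@sub_in_pairwise _ (mem K)) => [i j iK jK|]; [apply: hK | apply/allP => i; rewrite mem_enum].
- by rewrite size_map -cardE.
Qed.

(** * The graph Q and its join with K_8 *)

(* The complement of the circulant graph on Z/13 with connection set the
   nonzero cubes {1, 5, 8, 12}, i.e. of the Ramsey graph for R(3,5) > 13. *)
Definition qadj (i j : nat) : bool :=
  (i != j) && ((i + 13 - j) %% 13 \notin [:: 1; 5; 8; 12]).

Lemma qadj_sym (i j : 'I_13) : qadj i j = qadj j i.
Proof.
have /allP/(_ i) : all (fun i => all (fun j => qadj i j == qadj j i) (iota 0 13)) (iota 0 13).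
  by vm_compute.
by rewrite mem_iota ltn_ord => /(_ isT)/allP/(_ j); rewrite mem_iota ltn_ord => /(_ isT)/eqP.
Qed.

Lemma qadj_indep : ~~ has_clique (fun i j => ~~ qadj i j) 3 (iota 0 13).
Proof. by vm_compute. Qed.

Lemma qadj_cl : ~~ has_clique qadj 5 (iota 0 13).
Proof. by vm_compute. Qed.

Lemma qadj_split : clique_split qadj 3 4 (iota 0 13) [::] [::].
Proof. by vm_compute. Qed.

Local Notation KQ_vertex := ('I_8 + 'I_13)%type.

Definition KQ_adj : rel KQ_vertex := fun u v =>
  match u, v with
  | inl i, inl j => i != j
  | inr i, inr j => qadj i j
  | _, _ => true
  end.

Lemma KQ_sym : symmetric KQ_adj.
Proof. by move=> [i|i] [j|j] //=; [rewrite eq_sym | apply: qadj_sym]. Qed.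

Lemma KQ_irr : irreflexive KQ_adj.
Proof. by move=> [i|i]; rewrite /= ?eqxx // /qadj eqxx. Qed.

Definition KQ : sgraph := SGraph KQ_sym KQ_irr.

Lemma card_sum_set (K : {set KQ_vertex}) :
  #|K| = #|inl @^-1: K| + #|inr @^-1: K|.
Proof.
rewrite -!sum1_card big_sumType /=; congr (_ + _);
  by apply: eq_bigl => i; rewrite inE.
Qed.

Lemma cl_KQ : cl KQ < 13.
Proof.
rewrite ltnS; apply/bigmax_leqP => K; rewrite -[clique K]/(homog KQ_adj K) => /homogP hK.
rewrite card_sum_set (@leq_add _ _ 8 4) //.
  by have := max_card [in inl @^-1: K]; rewrite card_ord.
rewrite leqNgt; apply: contra qadj_cl => /ex_subset_card[L /subsetP sL cL].
suff : has_clique qadj #|L| (iota 0 13) by rewrite cL.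
apply: homog_has_clique; apply/homogP => i j /sL + /sL +; rewrite !inE => iK jK ij.
by have /= -> := hK (inr i) (inr j) iK jK _.
Qed.

Definition S8 : {set KQ} := inl @: [set: 'I_8].
Definition Q13 : {set KQ} := inr @: [set: 'I_13].

Lemma KQ_Q_indep : ~~ has_homog (fun x y => ~~ KQ_adj x y) 3 Q13.
Proof.
apply: contra qadj_indep => /has_homogP[K [sK cK /homogP hK]].
have cK' : #|inr @^-1: K| = 3.
  apply: etrans cK; rewrite [RHS]card_sum_set (_ : inl @^-1: K = set0) ?cards0 //.
  apply/setP => i; rewrite !inE; apply/negP => /(subsetP sK)/imsetP[j _].
  by [].
suff : has_clique (fun i j => ~~ qadj i j) #|inr @^-1: K| (iota 0 13) by rewrite cK'.
apply: homog_has_clique; apply/homogP => i j; rewrite !inE => iK jK ij.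
exact: hK (inr i) (inr j) iK jK ij.
Qed.

Lemma KQ_Q_split (X : {set KQ}) : X \subset Q13 ->
  has_homog KQ_adj 3 X || has_homog KQ_adj 4 (Q13 :\: X).
Proof.
(* [inord] sends every i >= 13 to 0, hence the bound [i < 13] carried by the predicates below. *)
move=> sX; pose f i : KQ := inr (inord i : 'I_13).
have to_homog k (Y : {set KQ}) t : all (fun i => (i < 13) && (f i \in Y)) t ->
    pairwise qadj t -> size t = k -> has_homog KQ_adj k Y.
  move=> /allP tY rt ct.
  apply: (has_homog_seq (t := map f t)); rewrite ?size_map //;
    [exact: KQ_sym | exact: KQ_irr | | ].
    rewrite pairwise_map; apply: (@sub_in_pairwise _ (fun i => i < 13)) rt.
      by move=> i j; rewrite !unfold_in => i13 j13 /=; rewrite !inordK.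
    by apply/allP => i /tY/andP[].
  by move=> _ /mapP[i /tY/andP[_ ?] ->].
pose p i := (i < 13) && (f i \in X); pose q i := (i < 13) && (f i \in Q13 :\: X).
have pq : all (predU p q) (iota 0 13).
  apply/allP => i; rewrite mem_iota /= => i13.
  by rewrite /p /q i13 in_setD imset_f ?inE // andbT orbN.
have [[t [pt rt ct]]|[t [qt rt ct]]] := clique_splitP (p := p) (q := q) qadj_split isT isT pq.
- by rewrite (to_homog 3 X t).
- by rewrite (to_homog 4 (Q13 :\: X) t) ?orbT.
Qed.

(** * From edge colorings to a red relation on vertices *)

Lemma set2_adj (G : sgraph) (x y a b : G) :
  [set x; y] = [set a; b] -> adj a b -> adj x y.
Proof.
move=> eq_xy ab; have ab_neq : a != b by apply: contraTneq ab => ->; rewrite adj_irr.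
have : x != y by have := cards2 x y; rewrite eq_xy cards2 ab_neq; case: (x != y).
have := set22 x y; have := set21 x y; rewrite eq_xy.
by case/set2P=> -> /set2P[] -> //; rewrite ?eqxx // adj_sym.
Qed.

Lemma KQ_arrows : edge_arrows KQ [tuple 3; 5].
Proof.
(* [c] takes bundled edges; quantifying over them makes [red] total, and false on non-adjacent
   pairs. *)
move=> c; pose red (x y : KQ) :=
  [exists d : edge KQ, (val d == [set x; y]) && (c d == ord0)].
have redC : symmetric red by move=> x y; rewrite /red setUC.
have red_adj : subrel red KQ_adj.
  move=> x y /existsP[d /andP[/eqP dxy _]]; have : val d \in edges KQ := valP d.
  rewrite inE.
  by case/existsP=> a /existsP[b /andP[ab /eqP]]; rewrite dxy => /set2_adj; apply.
have edgeP (d : edge KQ) (K : {set KQ}) : val d \subset K -> exists x y,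
    [/\ x \in K, y \in K, x != y, adj x y & (c d == ord0) = red x y].
  move=> sdK; have : val d \in edges KQ := valP d; rewrite inE.
  case/existsP=> x /existsP[y /andP[xy /eqP dxy]].
  move: sdK; rewrite dxy subUset !sub1set => /andP[xK yK].
  exists x, y; split=> //; first by apply: contraTneq xy => ->; rewrite adj_irr.
  apply/idP/existsP => [cd0|[d' /andP[/eqP d'xy]]]; first by exists d; rewrite dxy eqxx.
  (* An edge is determined by its two endpoints, so its color can be read off from [red]. *)
  by rewrite (_ : d' = d) //; apply: val_inj; rewrite d'xy dxy.
have [/has_homogP[K [_ cK hK]]|no_red3] := boolP (has_homog red 3 setT).
  exists ord0, K; split.
    by rewrite /pclique cK eqxx andbT; apply: homog_sub hK => x y _ _; apply: red_adj.
  move=> d /edgeP[x [y [xK yK xy _ cd]]]; apply/eqP.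
  by rewrite cd (homogP _ _ hK).
have [/has_homogP[K [_ cK hK]]|no_blue5] :=
    boolP (has_homog (fun x y => KQ_adj x y && ~~ red x y) 5 setT).
  exists ord_max, K; split.
    by rewrite /pclique cK eqxx andbT; apply: homog_sub hK => x y _ _ /andP[].
  move=> d /edgeP[x [y [xK yK xy _ cd]]].
  have := homogP _ _ hK x y xK yK xy; rewrite -cd => /andP[_].
  (* With only two colors, a nonzero one is [ord_max]. *)
  by case: (c d) => [[|[|]]] //= lt2 _; apply: val_inj.
case: (@join_no_coloring _ KQ_adj red S8 Q13 KQ_sym KQ_irr redC red_adj) => //.
- by apply/homogP => _ _ /imsetP[i _ ->] /imsetP[j _ ->]; apply: contra => /eqP->.
- by rewrite card_imset ?cardsT ?card_ord //; apply: inl_inj.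
- by rewrite card_imset ?cardsT ?card_ord //; apply: inr_inj.
- by move=> _ _ /imsetP[i _ ->] /imsetP[j _ ->].
- exact: KQ_Q_indep.
- exact: KQ_Q_split.
Qed.

(** Strong induction; excluded middle decides whether a smaller value satisfies [P], since arrowing
    over all graphs is not given as a boolean. *)
Lemma ex_minimum (P : nat -> Prop) n :
  P n -> exists m, [/\ P m, forall k, P k -> m <= k & m <= n].
Proof.
elim/ltn_ind: n => n IHn Pn.
have [[k [lt_kn Pk]]|no_less] := classic (exists k, k < n /\ P k).
  have [m [Pm min_m le_mk]] := IHn k lt_kn Pk.
  by exists m; split=> //; apply: leq_trans le_mk (ltnW lt_kn).
exists n; split=> // k Pk; rewrite leqNgt; apply/negP => lt_kn.
by apply: no_less; exists k.
Qed.

Theorem mainTheorem2 :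
  exists m : nat, edge_Folkman_number [tuple 3; 5] 13 m /\ m <= 21.
Proof.
pose P m := exists G : sgraph, [/\ #|G| = m, edge_arrows G [tuple 3; 5] & cl G < 13].
have P21 : P 21.
  exists KQ; split; [by rewrite card_sum !card_ord | exact: KQ_arrows | exact: cl_KQ].
have [m [Pm min_m le_m]] := ex_minimum P21.
exists m; split=> //; split=> // G arG clG.
by apply: min_m; exists G.
Qed.
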